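(* Let $n\ge 2$ be an integer and let $x,y$ be complex numbers such that no denominator below vanishes, i.e. $x\notin\{-1,\dots,-n\}$, $x-y\notin\{-1,\dots,-n\}$, $1+x-y+ny\ne0$ and $y\notin\{-n,-n+1,\dots,n-1\}$. Then $$\sum_{k=0}^n(-1)^k\binom{n}{k}\frac{\binom{y+k}{k}}{\binom{y-n+k}{k}}\frac{(y-1)y}{(y+k-1)(y+k)}H_{k}^{\langle2\rangle}(x)$$ $$=\frac{(-1)^n(1+x-y+ny)}{n(n-1)(1+x-y)}\,\frac{\binom{x-y+n}{n}}{\binom{x+n}{n}\binom{y}{n}}\bigg\{H_{n}(x)-H_{n}(x-y)+\frac{ny}{(1+x-y)(1+x-y+ny)}\bigg\}.$$
   Context: For a complex number $u$ and an integer $k\ge 0$, $\binom{u}{k}=\frac{u(u-1)\cdots(u-k+1)}{k!}$ (equal to $1$ for $k=0$). For a complex number $u$ and a positive integer $\ell$, the generalized harmonic numbers of $\ell$-order are $H_0^{\langle\ell\rangle}(u)=0$ and $H_n^{\langle\ell\rangle}(u)=\sum_{k=1}^n\frac{1}{(u+k)^\ell}$ for $n\ge1$; $H_n(u)=H_n^{\langle1\rangle}(u)$. *)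

(* Defs.v *)
From mathcomp Require Import all_boot all_order all_algebra.
Set Implicit Arguments.
Unset Strict Implicit.
Unset Printing Implicit Defensive.
Import GRing.Theory Num.Theory.
Local Open Scope ring_scope.

(* u (u - 1) ... (u - k + 1) / k!; the library binomial 'C(n, k) only takes
   natural number arguments. *)
Definition gbinom (F : numFieldType) (u : F) (k : nat) : F :=
  (\prod_(0 <= i < k) (u - i%:R)) / (k`!)%:R.

(* H_n^<l>(u); meant for l >= 1 and u + k <> 0 for 1 <= k <= n. *)
Definition gharmonic (F : numFieldType) (l n : nat) (u : F) : F :=
  \sum_(1 <= k < n.+1) 1 / (u + k%:R) ^+ l.

Definition harmonic (F : numFieldType) (n : nat) (u : F) : F :=
  gharmonic 1 n u.

(* Main.v *)
Require Import Defs.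
From mathcomp Require Import all_boot all_order all_algebra.
From mathcomp Require Import reals complex.
From mathcomp Require Import ring zify.
Import GRing.Theory Num.Theory.
Local Open Scope ring_scope.

(* The coefficient of H_k^<2>(x) in the sum is A_k - A_(k-1) for an explicit
   hypergeometric term A_k with A_n = 0 (Gosper summation), so summation by
   parts turns the left-hand side into - \sum_(k < n) A_k / (x + k + 1)^2, the
   derivative of F(x) = \sum_(k < n) A_k / (x + k + 1). Up to an additive
   constant, F is a multiple of N / P, where P = \prod_(1 <= i <= n) (X + i) and
   N = (X + 1 - y + n y) \prod_(2 <= i <= n) (X - y + i): both are monic of
   degree n, so that N / P - 1 is the sum of its simple fractions, and its
   residues are proportional to the A_k. The logarithmic derivatives of N and P
   then produce the harmonic numbers. *)

(** * Interpolation of a monic polynomial and the sum of its residues over squares *)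

Lemma horner_prod_XsubC (F : fieldType) (s : seq F) (P : pred F) (x : F) :
  (\prod_(z <- s | P z) ('X - z%:P)).[x] = \prod_(z <- s | P z) (x - z).
Proof. by rewrite horner_prod; apply: eq_bigr => z _; rewrite hornerXsubC. Qed.

Lemma deriv_prod_XsubC (F : fieldType) (s : seq F) (x : F) :
  x \notin s ->
  (\prod_(z <- s) ('X - z%:P))^`().[x]
  = (\prod_(z <- s) (x - z)) * \sum_(z <- s) (x - z)^-1.
Proof.
elim: s => [|z s IHs]; first by rewrite !big_nil derivC hornerC mulr0.
rewrite inE negb_or => /andP[xz xs].
rewrite !big_cons derivM derivXsubC !hornerE IHs // horner_prod_XsubC.
have xz0 : x - z != 0 by rewrite subr_eq0.
by field.
Qed.

(** Lagrange interpolation at the points of [s]. The leading terms of [N] and [P] cancel, so both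
    sides have size at most [size s]. They agree at each [z] in [s], where [P] vanishes and only the
    summand of index [z] survives. A nonzero difference would have too many roots. *)
Lemma monic_sub_interpolation (F : fieldType) (s : seq F) (N : {poly F}) :
  uniq s -> N \is monic -> size N = (size s).+1 ->
  N - \prod_(z <- s) ('X - z%:P)
  = \sum_(z <- s) (N.[z] / \prod_(w <- s | w != z) (z - w))
                    *: \prod_(w <- s | w != z) ('X - w%:P).
Proof.
move=> us mN sN; set P := \prod_(z <- s) _; set U := \sum_(z <- s) _.
apply/eqP; rewrite -subr_eq0; set V := _ - _; apply/negPn/negP => V0.
have sP : size P = (size s).+1 by rewrite size_prod_XsubC.
have mP : P \is monic by apply: monic_prod_XsubC.
have sNP : (size (N - P)%R <= size s)%N.
  apply/leq_sizeP => j; rewrite leq_eqVlt => /predU1P[<-|lj].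
    move: (monicP mN) (monicP mP); rewrite /lead_coef sN sP /= coefB => -> ->.
    by rewrite subrr.
  by rewrite coefB !nth_default ?subrr ?sN ?sP.
have sU : (size U <= size s)%N.
  rewrite /U big_seq; apply: (leq_trans (size_sum _ _ _)).
  apply/bigmax_leqP_seq => z _ zs; apply: (leq_trans (size_scale_leq _ _)).
  rewrite -big_filter size_prod_XsubC size_filter.
  have := count_predC (pred1 z) s; rewrite count_uniq_mem // zs => <-.
  by rewrite add1n.
have sV : (size V <= size s)%N.
  by apply: (leq_trans (size_polyD _ _)); rewrite size_polyN geq_max sNP sU.
have rV : all (root V) s.
  apply/allP => z zs; rewrite /root !hornerE horner_prod_XsubC horner_sum.
  rewrite (bigD1_seq z) //= subrr mul0r subr0 (bigD1_seq z) //= hornerZ.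
  rewrite horner_prod_XsubC mulfVK; last first.
    by rewrite prodf_seq_neq0; apply/allP => w _; rewrite subr_eq0 eq_sym; apply/implyP.
  rewrite big_seq_cond big1 ?addr0 ?subrr // => w /andP[ws wz].
  rewrite hornerZ horner_prod_XsubC (_ : \prod_(v <- s | _) (z - v) = 0) ?mulr0 //.
  apply/eqP; rewrite prodf_seq_eq0; apply/hasP; exists z => //.
  by rewrite subrr eqxx eq_sym wz.
by have := max_poly_roots V0 rV us; rewrite ltnNge sV.
Qed.

(** Division of the interpolation formula by P writes N / P - 1 as a sum of simple fractions c_z /
    (X - z). The left-hand side is minus the derivative of that sum at [x], and P' / P is the sum of
    the (x - z)^-1. *)
Lemma sum_residues_sqr (F : fieldType) (s : seq F) (N : {poly F}) (x : F) :
  uniq s -> N \is monic -> size N = (size s).+1 -> x \notin s ->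
  \sum_(z <- s) N.[z] / (\prod_(w <- s | w != z) (z - w)) / (x - z) ^+ 2
  = (N.[x] * (\sum_(z <- s) (x - z)^-1) - N^`().[x]) / \prod_(z <- s) (x - z).
Proof.
move=> us mN sN xs; set P := \prod_(z <- s) (x - z).
have P0 : P != 0.
  by rewrite prodf_seq_neq0; apply/allP => z zs; rewrite subr_eq0; apply: contraNneq xs => ->.
have xz0 z : z \in s -> x - z != 0.
  by move=> zs; rewrite subr_eq0; apply: contraNneq xs => ->.
have E := @monic_sub_interpolation F s N us mN sN.
have E0 := congr1 (fun p => p.[x]) E; have E1 := congr1 (fun p => p^`().[x]) E.
move: E0 E1; rewrite /= derivB !hornerD !hornerN horner_prod_XsubC.
rewrite deriv_prod_XsubC // (raddf_sum (@deriv F)) !horner_sum -/P.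
set H := \sum_(z <- s) (x - z)^-1 => E0 E1.
(* The two terms [P * H] cancel. They are inserted so that [E0] and [E1] can replace both brackets
   by sums over [s], which leaves one identity for each [z]. *)
suff -> : \sum_(z <- s) N.[z] / (\prod_(w <- s | w != z) (z - w)) / (x - z) ^+ 2
   = ((N.[x] - P) * H - (N^`().[x] - P * H)) / P by field.
rewrite E0 E1 mulr_suml -sumrB mulr_suml big_seq [RHS]big_seq.
apply: eq_bigr => z zs; have xz := xz0 z zs.
rewrite /= derivZ !hornerZ horner_prod_XsubC.
have -> : (\prod_(w <- s | w != z) ('X - w%:P))^`().[x]
    = (\prod_(w <- s | w != z) (x - w)) * \sum_(w <- s | w != z) (x - w)^-1.
  by rewrite -!(big_filter s) deriv_prod_XsubC // mem_filter (negPf xs) andbF.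
have Pz : P = (x - z) * \prod_(w <- s | w != z) (x - w) by exact: bigD1_seq.
have Hz : H = (x - z)^-1 + \sum_(w <- s | w != z) (x - w)^-1 by exact: bigD1_seq.
move: P0; rewrite Hz Pz mulf_eq0 negb_or => /andP[_].
move: (\prod_(w <- s | w != z) (x - w)) (\sum_(w <- s | w != z) _).
move: (N.[z] / _) => c Q h Q0.
by field; rewrite xz Q0.
Qed.

(** * Summation by parts and finite products *)

Lemma sum_by_parts (F : comPzRingType) (a A h : nat -> F) (n : nat) :
  a 0 = A 0 -> (forall k, (k < n)%N -> a k.+1 = A k.+1 - A k) ->
  \sum_(0 <= k < n.+1) a k * \sum_(1 <= j < k.+1) h j
  = A n * \sum_(1 <= j < n.+1) h j - \sum_(0 <= k < n) A k * h k.+1.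
Proof.
move=> a0; elim: n => [|n IHn] aS.
  by rewrite big_nat1 !big_geq // !mulr0 subr0.
rewrite big_nat_recr //= IHn => [|k lekn]; last by apply: aS; apply: ltnW.
rewrite aS // (@big_nat_recr _ _ _ n.+1 1) //= (@big_nat_recr _ _ _ n 0) //=.
by ring.
Qed.

Lemma gbinomDn (F : numFieldType) (u : F) (n : nat) :
  gbinom (u + n%:R) n = (\prod_(0 <= i < n) (u + i.+1%:R)) / n`!%:R.
Proof.
congr (_ / _); rewrite big_nat_rev; apply: eq_big_nat => i /andP[_ lin].
by rewrite add0n natrB // opprB addrCA addrK addrC.
Qed.

Lemma natr_fact_neq0 (F : numFieldType) (n : nat) : n`!%:R != 0 :> F.
Proof. by rewrite pnatr_eq0 -lt0n fact_gt0. Qed.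

Lemma prodrN_nat (F : comPzRingType) (f : nat -> F) (n : nat) :
  \prod_(0 <= i < n) - f i = (-1) ^+ n * \prod_(0 <= i < n) f i.
Proof. by rewrite !big_mkord prodrN card_ord. Qed.

Lemma prod_natr_succ (F : numFieldType) (n : nat) :
  \prod_(0 <= i < n) i.+1%:R = n`!%:R :> F.
Proof.
elim: n => [|n IHn]; first by rewrite big_nil.
by rewrite big_nat_recr //= IHn factS natrM mulrC.
Qed.

(** The factors with j < k give (-1)^k k!, those with j > k give (n - k)!. This is the denominator
    of the residue at the node -(k + 1). *)
Lemma prod_natr_sub (F : numFieldType) (n k : nat) : (k <= n)%N ->
  \prod_(0 <= j < n.+1 | j != k) (j%:R - k%:R)
  = (-1) ^+ k * (k`! * (n - k)`!)%:R :> F.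
Proof.
move=> lekn; rewrite (big_cat_nat (n := k)) //=; last exact: leqW.
rewrite [X in _ * X]big_ltn_cond ?ltnS // eqxx natrM mulrA; congr (_ * _).
  rewrite -prod_natr_succ -prodrN_nat big_nat_rev big_nat_cond [RHS]big_nat_cond.
  apply: eq_big => [i|i /andP[/andP[_ lik] _]].
    rewrite add0n andbT; case: ltnP => //= lik.
    by rewrite ltn_eqF // -subn_gt0 subKn.
  by rewrite add0n natrB // addrAC subrr add0r.
rewrite -prod_natr_succ -[k.+1]add0n big_addn subSS.
rewrite big_nat_cond [RHS]big_nat_cond; apply: eq_big => [i|i _].
  by rewrite andbT addnS gtn_eqF ?andbT // ltnS leq_addl.
by rewrite addnS -addSn natrD addrK.
Qed.

(** * The term A_k: telescoping and expression as a residue *)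

(* The term A_k of the header, with n = m + 2. *)
Definition partial_coef (F : numFieldType) (m : nat) (y : F) (k : nat) : F :=
  (-1) ^+ k * ('C(m.+1, k))%:R
  * ((\prod_(0 <= i < k) (y + i%:R)) / \prod_(0 <= i < k) (y - m.+2%:R + i.+1%:R))
  * (1 - k%:R / (m.+1%:R * y)).

Lemma prod_shifted_neq0 (F : numFieldType) (m k : nat) (y : F) :
  (forall i, (i < m)%N -> y - i%:R != 0) -> (k <= m)%N ->
  \prod_(0 <= i < k) (y - m%:R + i.+1%:R) != 0.
Proof.
move=> yBn0 lek; rewrite prodf_seq_neq0; apply/allP => i.
rewrite mem_index_iota /= => lik; have lim := leq_trans lik lek.
have -> : y - m%:R + i.+1%:R = y - (m - i.+1)%:R.
  by rewrite natrB // opprB addrA addrAC.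
by rewrite yBn0 // ltn_subrL /= (leq_ltn_trans _ lim).
Qed.

(** Once the binomials are reduced to ['C(m.+1, k)] and the products to [k] factors, these are
    common to all terms, and a rational identity in y, k and m remains. *)
Lemma partial_coefB (F : numFieldType) (m k : nat) (y : F) :
  (forall i, (i <= m.+2)%N -> y + i%:R != 0) ->
  (forall i, (i < m.+2)%N -> y - i%:R != 0) ->
  (k < m.+2)%N ->
  (-1) ^+ k.+1 * ('C(m.+2, k.+1))%:R
    * (gbinom (y + k.+1%:R) k.+1 / gbinom (y - m.+2%:R + k.+1%:R) k.+1)
    * (((y - 1) * y) / ((y + k.+1%:R - 1) * (y + k.+1%:R)))
  = partial_coef F m y k.+1 - partial_coef F m y k.
Proof.
move=> yDn0 yBn0 ltk; rewrite !gbinomDn /partial_coef.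
have y0 : y != 0 by have := yBn0 0 isT; rewrite subr0.
(* Shifting the product by one place brings out [y + k%:R] and [y + k.+1%:R], which cancel the two
   denominators of the summand of index [k.+1]. *)
have shift : y * \prod_(0 <= i < k.+1) (y + i.+1%:R)
    = \prod_(0 <= i < k) (y + i%:R) * (y + k%:R) * (y + k.+1%:R).
  by rewrite -!big_nat_recr // [RHS]big_nat_recl //= addr0.
have fk := natr_fact_neq0 F k.+1.
have q1 := prod_shifted_neq0 _ _ _ _ yBn0 ltk; have := q1.
rewrite big_nat_recr //= mulf_eq0 negb_or => /andP[q0 e0].
have binS : k.+1%:R * ('C(m.+2, k.+1))%:R = m.+2%:R * ('C(m.+1, k))%:R :> F.
  by rewrite -!natrM mul_bin_diag.
have binL : k.+1%:R * ('C(m.+1, k.+1))%:R = (m.+1%:R - k%:R) * ('C(m.+1, k))%:R :> F.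
  by rewrite -natrB // -!natrM mul_bin_left.
have k0 : k.+1%:R != 0 :> F by rewrite pnatr_eq0.
have m0 : m.+1%:R != 0 :> F by rewrite pnatr_eq0.
have yk : y + k%:R != 0 by apply: yDn0; apply: ltnW.
have yk1 : y + k.+1%:R != 0 by apply: yDn0.
have -> : ('C(m.+2, k.+1))%:R = m.+2%:R * ('C(m.+1, k))%:R / k.+1%:R :> F.
  by rewrite -binS mulrAC mulfV // mul1r.
have -> : ('C(m.+1, k.+1))%:R = (m.+1%:R - k%:R) * ('C(m.+1, k))%:R / k.+1%:R :> F.
  by rewrite -binL mulrAC mulfV // mul1r.
have -> : \prod_(0 <= i < k.+1) (y + i.+1%:R)
    = \prod_(0 <= i < k) (y + i%:R) * (y + k%:R) * (y + k.+1%:R) / y.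
  by rewrite -shift mulrAC mulfV // mul1r.
rewrite [\prod_(0 <= i < k.+1) (y + i%:R)]big_nat_recr //= exprS.
move: fk k0 m0 yk yk1 e0 q0; rewrite -!natr1.
set p := \prod_(0 <= i < k) (y + i%:R); set q := \prod_(0 <= i < k) _.
set f := k.+1`!%:R; set c := 'C(_, _)%:R; set sg := (-1) ^+ k.
move=> fk k0 m0 yk yk1 e0 q0; field.
have -> : y + (k%:R + 1) - 1 = y + k%:R by ring.
by rewrite y0 m0 q0 e0 k0 yk1 yk fk.
Qed.

(** Both sides are y times the product of the k + l consecutive factors from y - l to y + k - 1, cut
    below y on the left and below y - l + k on the right. *)
Lemma prod_shift (F : comPzRingType) (y : F) (k l : nat) :
  (\prod_(0 <= i < k) (y + i%:R)) * \prod_(0 <= i < l.+1) (y - i%:R)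
  = y * (\prod_(0 <= i < k) (y - l.+1%:R + i.+1%:R))
    * \prod_(0 <= i < l) (y + k%:R - i.+1%:R).
Proof.
elim: k => [|k IHk].
  rewrite !big_nil mul1r mulr1 big_nat_recl // subr0; congr (_ * _).
  by apply: eq_bigr => i _; rewrite addr0.
rewrite !(@big_nat_recr _ _ _ k) //= mulrAC IHk -!mulrA; congr (_ * (_ * _)).
rewrite mulrC; transitivity (\prod_(0 <= i < l.+1) (y + k%:R - i%:R)).
  by rewrite big_nat_recl // subr0.
rewrite big_nat_recr //= mulrC; congr (_ * _); first by rewrite -!natr1; ring.
by apply: eq_bigr => i _; rewrite -!natr1; ring.
Qed.

(** At the node -(k + 1), the factor X + 1 - y + n y of N equals (m + 1) y - k, a multiple of the
    last factor of A_k. The other factors of N come from the quotient of products in A_k by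
    [prod_shift]. *)
Lemma partial_coef_residue (F : numFieldType) (m k : nat) (y : F) :
  (forall i, (i < m.+2)%N -> y - i%:R != 0) ->
  (k < m.+2)%N ->
  partial_coef F m y k
  = - ((-1) ^+ m * m`!%:R / \prod_(0 <= i < m.+2) (y - i%:R))
    * ((- k.+1%:R - (y - 1 - m.+2%:R * y))
       * \prod_(0 <= i < m.+1) (- k.+1%:R - (y - i.+2%:R))
       / \prod_(0 <= j < m.+2 | j != k) (j%:R - k%:R)).
Proof.
move=> yBn0 ltk; rewrite prod_natr_sub // /partial_coef.
have binf : ('C(m.+1, k) * (k`! * (m.+1 - k)`!))%:R = m.+1%:R * m`!%:R :> F.
  by rewrite bin_fact // factS natrM.
have -> : \prod_(0 <= i < m.+1) (- k.+1%:R - (y - i.+2%:R))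
    = (-1) ^+ m.+1 * \prod_(0 <= i < m.+1) (y + k%:R - i.+1%:R).
  by rewrite -prodrN_nat; apply: eq_bigr => i _; rewrite -!natr1; ring.
have y0 : y != 0 by have := yBn0 0 isT; rewrite subr0.
have := prod_shift _ y k m.+1.
have m0 : m.+1%:R != 0 :> F by rewrite pnatr_eq0.
have q0 := prod_shifted_neq0 _ _ _ _ yBn0 (ltnW ltk).
have P0 : \prod_(0 <= i < m.+2) (y - i%:R) != 0.
  by rewrite prodf_seq_neq0; apply/allP => i; rewrite mem_index_iota; apply: yBn0.
have k0 := natr_fact_neq0 F k; have mk0 := natr_fact_neq0 F (m.+1 - k).
(* Only the parities of [k] and [m] remain in the signs, so that [field] can conclude in each of the
   four cases. *)
rewrite -(signr_odd _ k) -(signr_odd _ m) exprS -(signr_odd _ m).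
move: binf m0 q0 P0 k0 mk0; rewrite !natrM -!natr1.
set P := \prod_(_ <= i < m.+2) _; set q := \prod_(_ <= i < k) (y - _ + _).
set p := \prod_(_ <= i < k) _; set W := \prod_(_ <= i < m.+1) _.
set c := 'C(_, _)%:R; set kf := k`!%:R; set mkf := (m.+1 - k)`!%:R.
move=> binf m0 q0 P0 k0 mk0 shift.
have -> : c = (m%:R + 1) * m`!%:R / (kf * mkf).
  by rewrite -binf mulfK // mulf_neq0.
have -> : p = y * q * W / P by rewrite -shift mulfK.
by case: (odd k); case: (odd m); rewrite ?expr0 ?expr1; field;
  rewrite ?y0 ?m0 ?q0 ?P0 ?k0 ?mk0 ?oppr_eq0 ?oner_eq0.
Qed.

Lemma sum_partial_coef (F : numFieldType) (m : nat) (x y : F)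
  (yBn0 : forall i, (i < m.+2)%N -> y - i%:R != 0)
  (xn0 : forall i, (i < m.+2)%N -> x + i.+1%:R != 0)
  (xyn0 : forall i, (i < m.+2)%N -> x - y + i.+1%:R != 0)
  (xyn : x - (y - 1 - m.+2%:R * y) != 0) :
  \sum_(0 <= k < m.+2) partial_coef F m y k * (1 / (x + k.+1%:R) ^+ 2)
  = (-1) ^+ m * m`!%:R / (\prod_(0 <= i < m.+2) (y - i%:R))
    * ((x - (y - 1 - m.+2%:R * y)) * \prod_(0 <= i < m.+1) (x - y + i.+2%:R)
       / \prod_(0 <= i < m.+2) (x + i.+1%:R))
    * ((x - (y - 1 - m.+2%:R * y))^-1
       + \sum_(0 <= i < m.+1) (x - y + i.+2%:R)^-1
       - \sum_(0 <= i < m.+2) (x + i.+1%:R)^-1).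
Proof.
pose z k : F := - k.+1%:R.
pose s := [seq z k | k <- index_iota 0 m.+2].
(* The roots of N: first that of X + 1 - y + n y, then y - 2, ..., y - n. The root y - 1 is left
   out, which keeps the degree equal to n. *)
pose t := (y - 1 - m.+2%:R * y) :: [seq y - i.+2%:R | i <- index_iota 0 m.+1].
pose N := \prod_(w <- t) ('X - w%:P).
have zinj : injective z.
  by move=> i j /oppr_inj/eqP; rewrite eqr_nat => /eqP[].
have us : uniq s by rewrite map_inj_uniq ?iota_uniq.
have mN : N \is monic by apply: monic_prod_XsubC.
have sN : size N = (size s).+1.
  by rewrite size_prod_XsubC /= !size_map !size_iota.
have xs : x \notin s.
  apply/mapP => -[k]; rewrite mem_index_iota => /= lek /eqP.
  by rewrite -subr_eq0 opprK (negPf (xn0 _ lek)).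
have xt : x \notin t.
  rewrite inE negb_or -subr_eq0 xyn; apply/mapP => -[k].
  rewrite mem_index_iota => /= lek /eqP.
  by rewrite -subr_eq0 opprB addrA addrAC (negPf (xyn0 k.+1 lek)).
have prodt u : \prod_(w <- t) (u - w)
    = (u - (y - 1 - m.+2%:R * y)) * \prod_(0 <= i < m.+1) (u - (y - i.+2%:R)).
  by rewrite big_cons big_map.
have xBy i : x - (y - i.+2%:R) = x - y + i.+2%:R by ring.
have sumt : \sum_(w <- t) (x - w)^-1 = (x - (y - 1 - m.+2%:R * y))^-1
    + \sum_(0 <= i < m.+1) (x - y + i.+2%:R)^-1.
  rewrite big_cons big_map; congr (_ + _).
  by apply: eq_bigr => i _; rewrite xBy.
have prods : \prod_(w <- s) (x - w) = \prod_(0 <= i < m.+2) (x + i.+1%:R).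
  by rewrite big_map; apply: eq_bigr => i _; rewrite opprK.
have sums : \sum_(w <- s) (x - w)^-1 = \sum_(0 <= i < m.+2) (x + i.+1%:R)^-1.
  by rewrite big_map; apply: eq_bigr => i _; rewrite opprK.
pose C := (-1) ^+ m * m`!%:R / \prod_(0 <= i < m.+2) (y - i%:R).
transitivity (- C * \sum_(w <- s)
    N.[w] / (\prod_(v <- s | v != w) (w - v)) / (x - w) ^+ 2).
  rewrite mulr_sumr [RHS]big_map; apply: eq_big_nat => k /andP[_ ltk].
  rewrite partial_coef_residue // -/C horner_prod_XsubC prodt.
  have -> : \prod_(v <- s | v != z k) (z k - v)
      = \prod_(0 <= j < m.+2 | j != k) (j%:R - k%:R).
    rewrite big_map; apply: eq_big => [j|j _]; first by rewrite inj_eq.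
    by rewrite /z -!natr1; ring.
  by rewrite opprK div1r -!mulrA.
rewrite sum_residues_sqr // deriv_prod_XsubC // horner_prod_XsubC.
rewrite prodt prods sumt sums (eq_bigr _ (fun i _ => xBy i)) -/C.
by rewrite -mulrBr mulNr -mulrN -!mulrA; do 2!congr (_ * _); ring.
Qed.

Lemma harmonicE (F : numFieldType) (n : nat) (u : F) :
  harmonic n u = \sum_(0 <= i < n) (u + i.+1%:R)^-1.
Proof.
by rewrite /harmonic /gharmonic big_add1; apply: eq_bigr => i _; rewrite div1r.
Qed.

Theorem theorem14 (R : realType) (n : nat) (x y : R[i])
  (hn : (2 <= n)%N)
  (hx : forall j : nat, (1 <= j <= n)%N -> x != - j%:R)
  (hxy : forall j : nat, (1 <= j <= n)%N -> x - y != - j%:R)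
  (hxyn : 1 + x - y + n%:R * y != 0)
  (hy : forall m : int, - n%:Z <= m <= n%:Z - 1 -> y != m%:~R) :
  \sum_(0 <= k < n.+1)
    (-1) ^+ k * ('C(n, k))%:R
    * (gbinom (y + k%:R) k / gbinom (y - n%:R + k%:R) k)
    * (((y - 1) * y) / ((y + k%:R - 1) * (y + k%:R)))
    * gharmonic 2 k x
  = ((-1) ^+ n * (1 + x - y + n%:R * y))
      / (n%:R * (n%:R - 1) * (1 + x - y))
    * (gbinom (x - y + n%:R) n / (gbinom (x + n%:R) n * gbinom y n))
    * (harmonic n x - harmonic n (x - y)
       + (n%:R * y) / ((1 + x - y) * (1 + x - y + n%:R * y))).
Proof.
case: n hn hx hxy hxyn hy => [|[|m]] // _ hx hxy hxyn hy.
(* The excluded integers are split in two: [yDn0] handles the factors y + k, [yBn0] those of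
   [gbinom y n] and of the shifted binomials. *)
have yDn0 i : (i <= m.+2)%N -> y + i%:R != 0.
  move=> lei; rewrite addr_eq0 -[i%:R]/(i%:Z%:~R) -mulrNz; apply: hy; lia.
have yBn0 i : (i < m.+2)%N -> y - i%:R != 0.
  by move=> lei; rewrite subr_eq0; apply: (hy i%:Z); lia.
have xn0 i : (i < m.+2)%N -> x + i.+1%:R != 0.
  by move=> lei; rewrite addr_eq0; apply: hx.
have xyn0 i : (i < m.+2)%N -> x - y + i.+1%:R != 0.
  by move=> lei; rewrite addr_eq0; apply: hxy.
have y1 : y - 1 != 0 by apply: (yBn0 1).
have y0 : y != 0 by have := yBn0 0 isT; rewrite subr0.
rewrite (sum_by_parts _ _ (partial_coef _ m y)); first last.
- by move=> k; apply: partial_coefB.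
(* At k = 0 both sides are 1: the fraction is (y - 1) y / ((y - 1) y), with y different from 0 and
   1. *)
- rewrite /gbinom /partial_coef !big_nil !bin0 fact0 !mulr1n.
  rewrite mul0r !subr0 !mulr1 divr1 addr0.
  by rewrite !mulfV ?mulf_neq0 ?oner_neq0 // mulr1.
have -> : partial_coef R[i] m y m.+2 = 0.
  by rewrite /partial_coef bin_small // mulr0 !mul0r.
have xyn : x - (y - 1 - m.+2%:R * y) != 0.
  by move: hxyn; congr (_ != 0); ring.
have xy1 : x - y + 1 != 0 by apply: (xyn0 0).
have P0 (f : nat -> R[i]) n : (forall i, (i < n)%N -> f i != 0) ->
    \prod_(0 <= i < n) f i != 0.
  move=> f0; rewrite prodf_seq_neq0; apply/allP => i.
  by rewrite mem_index_iota; apply: f0.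
have X0 := P0 _ _ xn0; have Y0 := P0 _ _ yBn0.
rewrite mul0r sub0r sum_partial_coef // !gbinomDn !harmonicE [gbinom y _]/gbinom.
(* The factor x - y + 1, absent from N, is split off the binomial and the harmonic number. The last
   term of the braces is then 1 / (1 + x - y) - 1 / (1 + x - y + n y). *)
rewrite [\prod_(0 <= i < m.+2) (x - y + _)]big_nat_recl //=.
rewrite [\sum_(0 <= i < m.+2) (x - y + _)^-1]big_nat_recl //=.
have f0 := natr_fact_neq0 R[i] m.
have m1 : m%:R + 1 != 0 :> R[i] by rewrite natr1 pnatr_eq0.
have m2 : m%:R + 1 + 1 != 0 :> R[i] by rewrite !natr1 pnatr_eq0.
move: hxyn; rewrite !factS !natrM !exprS -!natr1.
set X := \prod_(0 <= i < m.+2) (x + _) in X0 *.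
set Y := \prod_(0 <= i < m.+2) (y - _) in Y0 *.
move=> hxyn; field.
by rewrite hxyn f0 m1 m2 X0 Y0 -addrA [1 + _]addrC xy1.
Qed.
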